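(* Let $k\in\mathbb{N}$, let $U\subseteq 2^{[k]}$, let $\mathbf{a}=(a_T\mid\varnothing\ne T\subseteq[k])$ be a family of integers and $\mathbf{b}=(b_T\mid T\in U)$ a family of integers, and define the polyhedron $$P_{\mathbf{a},\mathbf{b}}:=\Big\{(x_1,\dots,x_k)\in\mathbb{R}^k\ \Big|\ \sum_{i\in T}x_i\ge a_T\text{ for all }\varnothing\ne T\subseteq[k],\ \sum_{i\in T}x_i\le b_T\text{ for all }T\in U\Big\}.$$ Either $P_{\mathbf{a},\mathbf{b}}$ is empty or there exist (finitely many, $t\ge 0$) pairwise disjoint, pointed rational cones $C_1,\dots,C_t\subset\mathbb{R}^k$ with integral apices such that $$P_{\mathbf{a},\mathbf{b}}\cap\mathbb{Z}^k=\bigcup_{i=1}^t(C_i\cap\mathbb{Z}^k).$$ Moreover, each cone $C_i$ is of the form $$C_i=\{(x_1,\dots,x_k)\in\mathbb{R}^k\mid x_j=c_j\text{ for }j\in J,\ x_j\ge c_j\text{ for }j\in[k]-J\}$$ for some $J\subseteq[k]$ and some $(c_1,\dots,c_k)\in\mathbb{Z}^k$ (depending on $i$).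
   Context: $\mathbb{N}$ denotes the positive integers, $[k]=\{1,\dots,k\}$ and $2^{[k]}$ is the power set of $[k]$. A ''cone'' here may have apex different from the origin (a translate of a cone). The set $U$ may be empty. *)

(* Defs.v *)
From mathcomp Require Import all_boot all_order all_algebra.
From mathcomp Require Import boolp classical_sets reals.

Set Implicit Arguments.
Unset Strict Implicit.
Unset Printing Implicit Defensive.

Import Order.TTheory GRing.Theory Num.Theory.

Local Open Scope classical_set_scope.
Local Open Scope ring_scope.

(* The families [a] and [b] are total functions on {set 'I_k}; only the values
   of [a] at nonempty sets and those of [b] on [U] are used.  If [U] contains
   the empty set, the corresponding constraint reads 0 <= b_set0. *)
Definition polyhedron (R : realType) (k : nat) (U : {set {set 'I_k}})
    (a b : {set 'I_k} -> int) : set 'rV[R]_k :=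
  [set x : 'rV[R]_k |
    (forall T : {set 'I_k}, T != finset.set0 ->
       (a T)%:~R <= \sum_(i in T) x ord0 i) /\
    (forall T : {set 'I_k}, T \in U ->
       \sum_(i in T) x ord0 i <= (b T)%:~R)].

Definition integer_points (R : realType) (k : nat) : set 'rV[R]_k :=
  [set x : 'rV[R]_k | forall i, x ord0 i \is a Num.int].

Arguments polyhedron R {k} U a b _.
Arguments integer_points R k _ : clear implicits.

(* [m = 0] is allowed and gives the single point [v]. *)
Definition rational_cone (R : realType) (k : nat) (v : 'rV[R]_k)
    (C : set 'rV[R]_k) : Prop :=
  exists (m : nat) (g : 'I_m -> 'rV[rat]_k),
    C = [set x : 'rV[R]_k | exists lambda : 'I_m -> R,
          (forall i, 0 <= lambda i) /\
          x = v + \sum_(i < m) lambda i *: map_mx ratr (g i)].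

(* A cone is pointed when it contains no line. *)
Definition pointed_set (R : realType) (k : nat) (C : set 'rV[R]_k) : Prop :=
  forall u w : 'rV[R]_k, (forall s : R, C (u + s *: w)) -> w = 0.

Definition pointed_rational_cone_integral_apex (R : realType) (k : nat)
    (C : set 'rV[R]_k) : Prop :=
  pointed_set C /\ exists2 v, integer_points R k v & rational_cone v C.

Definition shifted_orthant (R : realType) (k : nat) (J : {set 'I_k})
    (c : 'I_k -> int) : set 'rV[R]_k :=
  [set x : 'rV[R]_k |
    (forall j, j \in J -> x ord0 j = (c j)%:~R) /\
    (forall j, j \notin J -> (c j)%:~R <= x ord0 j)].

Arguments shifted_orthant R {k} J c _.

(* Main.v *)
(** The singleton constraints bound each coordinate from below by
    [a {j}].  Fix a large [N].  As soon as some [x_i] with [i \in T] is at least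
    [a {i} + N], the lower constraint on [T] holds and the upper one fails,
    whatever the other coordinates are.  Hence membership of a lattice point
    depends only on its coordinates truncated at [a {j} + N], and each feasible
    truncated point [c] contributes the orthant in which the coordinates below
    the threshold are frozen and the others are free to grow. *)
Require Import Defs.
From mathcomp Require Import all_boot all_order all_algebra.
From mathcomp Require Import boolp classical_sets reals.
From mathcomp Require Import zify lra.

Set Implicit Arguments.
Unset Strict Implicit.
Unset Printing Implicit Defensive.

Import Order.TTheory GRing.Theory Num.Theory.

Local Open Scope classical_set_scope.
Local Open Scope ring_scope.

Lemma pointed_shifted_orthant (R : realType) (k : nat) (J : {set 'I_k})
    (c : 'I_k -> int) : pointed_set (shifted_orthant R J c).
Proof.
move=> u w line; apply/rowP => j; rewrite mxE; apply/eqP/negPn/negP => w0.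
(* At this parameter coordinate [j] of the line equals [c j - 1], which is too small whether or not
   [j] is in [J]. *)
have [eqJ geJ] := line (((c j)%:~R - 1 - u ord0 j) / w ord0 j).
have : (c j)%:~R <= (u + ((c j)%:~R - 1 - u ord0 j) / w ord0 j *: w) ord0 j.
  by have [/eqJ->|/geJ] := boolP (j \in J).
rewrite !mxE divfK//; lra.
Qed.

Lemma rational_cone_shifted_orthant (R : realType) (k : nat) (J : {set 'I_k})
    (c : 'I_k -> int) :
  rational_cone (\row_j (c j)%:~R) (shifted_orthant R J c).
Proof.
(* Free coordinates get their unit vector. Frozen ones get the zero vector, so that the generators
   can be indexed by all of ['I_k]. *)
exists k, (fun i => if i \in J then 0 else delta_mx ord0 i).
have sumE (l : 'I_k -> R) j :
    (\sum_(i < k) l i *: map_mx ratr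
        (if i \in J then 0 else delta_mx ord0 i : 'rV[rat]_k)) ord0 j
    = if j \in J then 0 else l j.
  rewrite summxE (bigD1 j)//= big1 ?addr0 => [|i ij].
    by case: ifP => _; rewrite !mxE ?rmorph0 ?mulr0// !eqxx rmorph1 mulr1.
  case: ifP => _; rewrite !mxE ?rmorph0 ?mulr0//.
  by rewrite [j == i]eq_sym (negPf ij) andbF rmorph0 mulr0.
apply/seteqP; split => x /= [].
  move=> eqJ geJ; exists (fun j => if j \in J then 0 else x ord0 j - (c j)%:~R).
  split=> [j|]; first by case: ifPn => // /geJ; rewrite subr_ge0.
  apply/rowP => j; rewrite mxE sumE mxE.
  by have [/eqJ->|_] := boolP (j \in J); rewrite ?addr0// addrC subrK.
move=> l [l0 ->]; split=> j jJ; rewrite mxE sumE mxE.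
  by rewrite jJ addr0.
by rewrite (negPf jJ) lerDl.
Qed.

(** Boolean and over the integers, so that the feasible truncated points can be counted and
    enumerated. *)
Definition feasible (k : nat) (U : {set {set 'I_k}})
    (a b : {set 'I_k} -> int) (y : 'I_k -> int) : bool :=
  [forall T : {set 'I_k}, (T != finset.set0) ==> (a T <= \sum_(i in T) y i)] &&
  [forall T : {set 'I_k}, (T \in U) ==> (\sum_(i in T) y i <= b T)].

Section Feasible.
Variables (k : nat) (U : {set {set 'I_k}}) (a b : {set 'I_k} -> int).

Lemma feasibleP (y : 'I_k -> int) :
  reflect ((forall T : {set 'I_k}, T != finset.set0 -> a T <= \sum_(i in T) y i)
           /\ (forall T : {set 'I_k}, T \in U -> \sum_(i in T) y i <= b T))
          (feasible U a b y).
Proof.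
by apply: (iffP andP) => -[lo up]; split; apply/forall_inP.
Qed.

Lemma polyhedron_intE (R : realType) (x : 'rV[R]_k) (y : 'I_k -> int) :
  (forall i, x ord0 i = (y i)%:~R) ->
  polyhedron R U a b x <-> feasible U a b y.
Proof.
move=> xy.
have sumE (T : {set 'I_k}) :
    \sum_(i in T) x ord0 i = (\sum_(i in T) y i)%:~R.
  by rewrite rmorph_sum; apply: eq_bigr => i _; rewrite xy.
split=> [[lo up]|/feasibleP[lo up]].
  apply/feasibleP; split=> T hT; rewrite -(ler_int R) -sumE.
    exact: lo.
  exact: up.
split=> T hT; rewrite sumE ler_int.
  exact: lo.
exact: up.
Qed.

Definition lower (j : 'I_k) : int := a (finset.set1 j).

Lemma feasible_lower (y : 'I_k -> int) j : feasible U a b y -> lower j <= y j.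
Proof.
move=> /feasibleP[lo _]; have := lo (finset.set1 j); rewrite big_set1; apply.
by apply/set0Pn; exists j; rewrite finset.in_set1.
Qed.

(** Summing over all [T] gives one threshold that works for every [T]; the successor makes the
    comparison strict. *)
Definition saturation : nat :=
  (\sum_(T : {set 'I_k}) (`|a T| + `|b T| + `|(\sum_(j in T) lower j)%R|)).+1.

(** The coordinates other than [i] contribute at least their lower bounds, and [saturation] exceeds
    the absolute values of [a T], [b T] and the sum of the lower bounds over [T] taken together. *)
Lemma saturated_sum (T : {set 'I_k}) (y : 'I_k -> int) i :
  i \in T -> (forall j, lower j <= y j) ->
  lower i + saturation%:Z <= y i ->
  a T <= \sum_(j in T) y j /\ b T < \sum_(j in T) y j.
Proof.
move=> iT ylo yi.
have : \sum_(j in T) lower j + saturation%:Z <= \sum_(j in T) y j.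
  rewrite (bigD1 i)//= [leRHS](bigD1 i)//= addrAC lerD//.
  exact: ler_sum.
have : (`|a T| + `|b T| + `|(\sum_(j in T) lower j)%R| < saturation)%N.
  by rewrite ltnS (bigD1 T)//= leq_addr.
lia.
Qed.

(** If [y] and [z] agree on [T], the sums are equal. Otherwise both are saturated at some coordinate
    in [T]: the lower constraint then holds for [z], and [T] cannot lie in [U] because [y] would
    violate the upper one. *)
Lemma feasible_saturate (y z : 'I_k -> int) :
  (forall j, lower j <= z j) ->
  (forall j, z j = y j \/ lower j + saturation%:Z <= y j
                          /\ lower j + saturation%:Z <= z j) ->
  feasible U a b y -> feasible U a b z.
Proof.
move=> zlo yz fy; have ylo j := feasible_lower j fy.
have [lo up] := feasibleP _ fy.
have sumE (T : {set 'I_k}) : \sum_(j in T) z j = \sum_(j in T) y j \/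
    exists2 i, i \in T & lower i + saturation%:Z <= y i
                         /\ lower i + saturation%:Z <= z i.
  have [/exists_inP[i iT ziy]|] := boolP [exists i in T, z i != y i].
    by right; exists i => //; case: (yz i) => // /eqP; rewrite (negPf ziy).
  rewrite negb_exists_in => /forall_inP zy; left; apply: eq_bigr => j jT.
  by apply/eqP/negPn/zy.
apply/feasibleP; split=> T hT; case: (sumE T) => [->|[i iT [yi zi]]].
- exact: lo.
- by case: (saturated_sum iT zlo zi).
- exact: up.
- by case: (saturated_sum iT ylo yi) => _; rewrite ltNge up.
Qed.

End Feasible.

Section Decomposition.
Variables (R : realType) (k : nat) (lo : 'I_k -> int) (N : nat).
Implicit Types f : {ffun 'I_k -> 'I_N.+1}.

(** [f] records offsets from [lo]; the top value [N] stands for every offset of at least [N]. *)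
Definition box_point f (j : 'I_k) : int := lo j + (f j : nat)%:Z.

Definition box_orthant f : set 'rV[R]_k :=
  shifted_orthant R (finset.finset (fun j => (f j < N)%N)) (box_point f).

Lemma box_orthantP f (x : 'rV[R]_k) : box_orthant f x <->
  forall j, if (f j < N)%N then x ord0 j = (box_point f j)%:~R
            else (box_point f j)%:~R <= x ord0 j.
Proof.
split=> [[eqJ geJ] j|xf].
  by case: ifP => fj; [apply: eqJ | apply: geJ]; rewrite finset.in_set fj.
by split=> j; have := xf j; rewrite finset.in_set; case: ifP.
Qed.

(** A frozen coordinate determines its offset and lies strictly below [lo j + N], where free
    coordinates start; two free ones both have offset [N]. *)
Lemma box_orthant_inj f g (x : 'rV[R]_k) :
  box_orthant f x -> box_orthant g x -> f = g.
Proof.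
move=> /box_orthantP xf /box_orthantP xg; apply/ffunP => j; apply/val_inj => /=.
move: (xf j) (xg j) (ltn_ord (f j)) (ltn_ord (g j)); rewrite /box_point.
case: ltnP => fN; case: ltnP => gN.
- by move=> -> /intr_inj; lia.
- by move=> ->; rewrite ler_int; lia.
- by move=> /[swap] ->; rewrite ler_int; lia.
- lia.
Qed.

Lemma box_orthant_cover (x : 'rV[R]_k) (y : 'I_k -> int) :
  (forall j, x ord0 j = (y j)%:~R) -> (forall j, lo j <= y j) ->
  exists f, box_orthant f x.
Proof.
(* The offset truncated at [N]; the absolute value only converts to [nat], since [lo j <= y j]. *)
move=> xy ylo; exists [ffun j => inord (minn `|y j - lo j| N)].
apply/box_orthantP => j; rewrite /box_point ffunE inordK ?ltnS ?geq_minr//.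
rewrite xy ler_int; have := ylo j; case: ltnP => h yj; first congr (_%:~R); lia.
Qed.

(** Supplies the hypotheses of [feasible_saturate] relating a lattice point to its truncation, in
    either direction. *)
Lemma box_orthant_int f (x : 'rV[R]_k) (y : 'I_k -> int) :
  (forall j, x ord0 j = (y j)%:~R) -> box_orthant f x ->
  forall j, lo j <= y j /\
    (y j = box_point f j \/
     lo j + N%:Z <= box_point f j /\ lo j + N%:Z <= y j).
Proof.
move=> xy /box_orthantP xf j; move: (xf j); rewrite xy ler_int /box_point.
by case: ltnP => fN; [move=> /intr_inj|]; lia.
Qed.

End Decomposition.

Theorem theorem7p2 (R : realType) (k : nat) (hk : (0 < k)%N)
    (U : {set {set 'I_k}}) (a b : {set 'I_k} -> int) :
  polyhedron R U a b = set0 \/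
  exists (t : nat) (C : 'I_t -> set 'rV[R]_k),
    [/\ trivIset [set: 'I_t] C,
        forall i, pointed_rational_cone_integral_apex (C i),
        polyhedron R U a b `&` integer_points R k =
          \bigcup_(i in [set: 'I_t]) (C i `&` integer_points R k) &
        forall i, exists (J : {set 'I_k}) (c : 'I_k -> int),
          C i = shifted_orthant R J c].
Proof.
(* An empty polyhedron is covered too: no [f] is then [good], and the family has [t = 0] cones. *)
right.
pose N := saturation a b.
pose good : pred {ffun 'I_k -> 'I_N.+1} :=
  fun f => feasible U a b (box_point (lower a) f).
have intE (x : 'rV[R]_k) : integer_points R k x ->
    forall j, x ord0 j = (Num.floor (x ord0 j))%:~R.
  by move=> xint j; rewrite floorK.
exists #|good|, (fun i => box_orthant (lower a) (enum_val i)); split.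
- move=> i j _ _ [x [xi xj]].
  exact/enum_val_inj/(box_orthant_inj xi xj).
- move=> i; split; first exact: pointed_shifted_orthant.
  exists (\row_j (box_point (lower a) (enum_val i) j)%:~R).
    by move=> j; rewrite mxE rpred_int.
  exact: rational_cone_shifted_orthant.
- apply/seteqP; split => x.
    move=> [/(polyhedron_intE U a b) xP xint].
    have fx : feasible U a b (fun j => Num.floor (x ord0 j)).
      exact/xP/intE.
    have [f xf] := box_orthant_cover N (intE x xint) (fun j => feasible_lower j fx).
    have gf : f \in good.
      (* Feasibility passes from the lattice point to its truncation. *)
      apply: feasible_saturate fx => j; first by rewrite /box_point lerDl.
      by case: (box_orthant_int (intE x xint) xf j) => _ [->|[]]; [left | right].
    by exists (enum_rank_in gf f) => //; split=> //; rewrite enum_rankK_in.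
  move=> [i _ [xi xint]]; split=> //; apply/polyhedron_intE; first exact: intE.
  have gi : feasible U a b (box_point (lower a) (enum_val i)) := enum_valP i.
  (* Conversely, it passes from the truncated point to every lattice point of its orthant. *)
  apply: feasible_saturate gi => j; first by case: (box_orthant_int (intE x xint) xi j).
  by case: (box_orthant_int (intE x xint) xi j).
- by move=> i; eexists; eexists.
Qed.
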